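(* Let $A$ and $B$ be two asynchronously composable IOTSes that are weakly asynchronously compatible. If $A\otimes B^\rhd_{\mathit{out}_{BA}}$ is autonomously deadlock-free or $A^\rhd_{\mathit{out}_{AB}}\otimes B$ is autonomously deadlock-free, then $A\otimes_{as}B$ is asynchronously deadlock-free.
   Context: An IOTS $A=(\mathit{states}_A,\mathit{start}_A,\mathit{act}_A,\to_A)$ has states, initial state, actions $\mathit{act}_A=\mathit{in}_A\cup\mathit{out}_A\cup\mathit{int}_A$ (disjoint union of inputs, outputs, internal actions) and transitions $s\xrightarrow{a}_A s'$. $s\ (\xrightarrow{X})^*_A\ s'$ denotes a possibly empty finite sequence of transitions labelled in $X$; $\mathit{reach}(A)$ is the set of states reachable from $\mathit{start}_A$. $A,B$ are composable if $\mathit{act}_A\cap\mathit{act}_B=(\mathit{in}_A\cap\mathit{out}_B)\cup(\mathit{in}_B\cap\mathit{out}_A)=:\mathit{shared}(A,B)$. Synchronous composition $A\otimes B$: states $\mathit{states}_A\times\mathit{states}_B$, initial $(\mathit{start}_A,\mathit{start}_B)$, inputs $(\mathit{in}_A\cup\mathit{in}_B)\setminus\mathit{shared}(A,B)$, outputs $(\mathit{out}_A\cup\mathit{out}_B)\setminus\mathit{shared}(A,B)$, internal $\mathit{int}_A\cup\mathit{int}_B\cup\mathit{shared}(A,B)$; a non-shared action of one component moves only that component; a shared action $a$ yields $(s,t)\xrightarrow{a}(s',t')$ when $s\xrightarrow{a}_A s'$ and $t\xrightarrow{a}_B t'$. For a set $M$, $M^\rhd=\{a^\rhd\mid a\in M\}$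 are fresh names. For $M\subseteq\mathit{out}_A$, $A^\rhd_M$ is $A$ with every $a\in M$ renamed to $a^\rhd$ (an output of $A^\rhd_M$). $A,B$ are asynchronously composable if composable and $\mathit{shared}(A,B)^\rhd\cap(\mathit{act}_A\cup\mathit{act}_B)=\emptyset$. Let $\mathit{out}_{AB}=\mathit{out}_A\cap\mathit{in}_B$, $\mathit{out}_{BA}=\mathit{out}_B\cap\mathit{in}_A$. $\Omega(A)$ is the IOTS with states $(s,q)$, $s\in\mathit{states}_A$, $q\in\mathit{out}_{AB}^*$, initial $(\mathit{start}_A,\epsilon)$, inputs $\mathit{in}_A$, outputs $\mathit{out}_A$, internal $\mathit{int}_A\cup\mathit{out}_{AB}^\rhd$, transitions $(s,q)\xrightarrow{a}(s',q)$ if $s\xrightarrow{a}_A s'$, $a\notin\mathit{out}_{AB}$; $(s,q)\xrightarrow{a^\rhd}(s',qa)$ if $s\xrightarrow{a}_A s'$, $a\in\mathit{out}_{AB}$; $(s,aq)\xrightarrow{a}(s,q)$ for $a\in\mathit{out}_{AB}$. $\Omega(B)$ analogously with $\mathit{out}_{BA}$. $A\otimes_{as}B=\Omega(A)\otimes\Omega(B)$. IOTSes $C,D$ are weakly synchronously compatible if composable and for all $(s_C,s_D)\in\mathit{reach}(C\otimes D)$ and $a\in\mathit{out}_C\cap\mathit{in}_D$ with $s_C\xrightarrow{a}_C s_C'$ there exist $\bar s_D,s_D'$ with $s_D\ (\xrightarrow{\mathit{int}_D})^*_D\ \bar s_D\xrightarrow{a}_D s_D'$, and symmetrically. $A,B$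 are weakly asynchronously compatible if $\Omega(A)$ and $\Omega(B)$ are weakly synchronously compatible. $A\otimes_{as}B$ is asynchronously deadlock-free if every reachable state of $\Omega(A)\otimes\Omega(B)$ has an outgoing transition. $A\otimes B^\rhd_{\mathit{out}_{BA}}$ is autonomously deadlock-free if for each $(s_A,s_B)\in\mathit{reach}(A\otimes B^\rhd_{\mathit{out}_{BA}})$ there is a transition $(s_A,s_B)\xrightarrow{a}(s_A',s_B')$ of $A\otimes B^\rhd_{\mathit{out}_{BA}}$ with $a\notin\mathit{in}_A\cap\mathit{out}_B$. Autonomous deadlock-freeness of $A^\rhd_{\mathit{out}_{AB}}\otimes B$ is defined analogously (a transition with label not in $\mathit{in}_B\cap\mathit{out}_A$ from every reachable state). *)

(* Defs.v *)
From mathcomp Require Import all_boot classical_sets boolp.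
From Stdlib Require Import Relations.

Set Implicit Arguments.
Unset Strict Implicit.
Unset Printing Implicit Defensive.

Local Open Scope classical_set_scope.

(* The action sets of an IOTS are subsets of an ambient type Act.  The fresh
   names a^▷ are given by a map rhd : Act -> Act, a parameter of the notions
   that use it; the main theorem assumes it injective, and freshness is the
   disjointness condition in async_composable. *)

(* The data of an IOTS; the conditions on the data are in is_iots, so that the
   operations below are total functions. *)
Record iots (Act : Type) := Iots {
  state : Type;
  start : state;
  inputs : set Act;
  outputs : set Act;
  internals : set Act;
  step : state -> Act -> state -> Prop
}.

Arguments step {Act} _ _ _ _.

Section Iots.
Variable Act : Type.
Implicit Types (A B C D : iots Act) (X M : set Act).

Definition actions A : set Act := inputs A `|` outputs A `|` internals A.

Definition is_iots A : Prop :=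
  [/\ inputs A `&` outputs A = set0,
      inputs A `&` internals A = set0,
      outputs A `&` internals A = set0 &
      forall s a s', step A s a s' -> actions A a].

Definition steps A X : state A -> state A -> Prop :=
  clos_refl_trans_1n (state A) (fun s s' => exists2 a, X a & step A s a s').

Arguments steps : clear implicits.

Definition reach A : set (state A) := [set s | steps A (actions A) (start A) s].

Arguments reach : clear implicits.

Definition shared A B : set Act :=
  (inputs A `&` outputs B) `|` (inputs B `&` outputs A).

Definition composable A B : Prop := actions A `&` actions B = shared A B.

Inductive sync_step A B :
    state A * state B -> Act -> state A * state B -> Prop :=
  | SyncLeft s s' t a : ~ shared A B a -> step A s a s' ->
      sync_step (s, t) a (s', t)
  | SyncRight s t t' a : ~ shared A B a -> step B t a t' ->
      sync_step (s, t) a (s, t')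
  | SyncBoth s s' t t' a : shared A B a -> step A s a s' -> step B t a t' ->
      sync_step (s, t) a (s', t').

Definition sync A B : iots Act := {|
  state := (state A * state B)%type;
  start := (start A, start B);
  inputs := (inputs A `|` inputs B) `\` shared A B;
  outputs := (outputs A `|` outputs B) `\` shared A B;
  internals := internals A `|` internals B `|` shared A B;
  step := @sync_step A B |}.

Definition weakly_sync_compatible C D : Prop :=
  [/\ composable C D,
      forall (s : state C) (t : state D) a s',
        reach (sync C D) (s, t) -> (outputs C `&` inputs D) a ->
        step C s a s' ->
        exists t1 t', steps D (internals D) t t1 /\ step D t1 a t' &
      forall (s : state C) (t : state D) a t',
        reach (sync C D) (s, t) -> (outputs D `&` inputs C) a ->
        step D t a t' ->
        exists s1 s', steps C (internals C) s s1 /\ step C s1 a s'].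

Definition deadlock_free C : Prop :=
  forall s, reach C s -> exists a s', step C s a s'.

(* X is the set of labels that do not count as progress. *)
Definition autonomously_deadlock_free C X : Prop :=
  forall s, reach C s -> exists a s', step C s a s' /\ ~ X a.

Variable rhd : Act -> Act.

(* A^▷_M, meant for M `<=` outputs A *)
Inductive rename_step M A : state A -> Act -> state A -> Prop :=
  | RenameOther s a s' : ~ M a -> step A s a s' -> rename_step M s a s'
  | RenameRhd s a s' : M a -> step A s a s' -> rename_step M s (rhd a) s'.

Definition rename M A : iots Act := {|
  state := state A;
  start := start A;
  inputs := inputs A;
  outputs := (outputs A `\` M) `|` (rhd @` M);
  internals := internals A;
  step := @rename_step M A |}.

Definition async_composable A B : Prop :=
  composable A B /\
  (rhd @` shared A B) `&` (actions A `|` actions B) = set0.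

(* out_AB *)
Definition out_to A B : set Act := outputs A `&` inputs B.

(* Ω(A), where B is the partner; queues are words over the set out_AB. *)
Inductive omega_step A B :
    state A * seq (out_to A B) -> Act -> state A * seq (out_to A B) -> Prop :=
  | OmegaMove s s' q a : ~ out_to A B a -> step A s a s' ->
      omega_step (s, q) a (s', q)
  | OmegaEnqueue s s' q (a : out_to A B) : step A s (val a) s' ->
      omega_step (s, q) (rhd (val a)) (s', rcons q a)
  | OmegaDequeue s q (a : out_to A B) :
      omega_step (s, a :: q) (val a) (s, q).

Definition omega A B : iots Act := {|
  state := (state A * seq (out_to A B))%type;
  start := (start A, [::]);
  inputs := inputs A;
  outputs := outputs A;
  internals := internals A `|` (rhd @` out_to A B);
  step := @omega_step A B |}.

Definition async A B : iots Act := sync (omega A B) (omega B A).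

Definition weakly_async_compatible A B : Prop :=
  weakly_sync_compatible (omega A B) (omega B A).

Definition async_deadlock_free A B : Prop := deadlock_free (async A B).

Let disjP X M : X `&` M = set0 -> forall a, X a -> M a -> False.
Proof. by move=> XM a Xa Ma; have : (X `&` M) a by []; rewrite XM. Qed.

Let disjI X M : (forall a, X a -> M a -> False) -> X `&` M = set0.
Proof. by move=> XM; rewrite -subset0 => a [Xa Ma]; exact: (XM a). Qed.

Let compP A B : composable A B ->
  forall a, actions A a -> actions B a -> shared A B a.
Proof. by move=> <- a. Qed.

Lemma is_iots_sync A B :
  is_iots A -> is_iots B -> composable A B -> is_iots (sync A B).
Proof.
move=> [/disjP a1 /disjP a2 /disjP a3 a4] [/disjP b1 /disjP b2 /disjP b3 b4].
move=> /compP cAB; rewrite /actions /shared in cAB a4 b4.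
split; [apply: disjI => a|apply: disjI => a|apply: disjI => a|];
  rewrite /= /actions /= /setU /setD /setI /shared /= ?/setU ?/setI /=.
- have := a1 a; have := b1 a; tauto.
- move: (a2 a) (b2 a) (cAB a); rewrite /setU /setI /=; tauto.
- move: (a3 a) (b3 a) (cAB a); rewrite /setU /setI /=; tauto.
move=> s a s' [s0 s0' t a0|s0 t t' a0|s0 s0' t t' a0];
  rewrite /shared /setU /setI /=.
- by move=> ? /a4; rewrite /setU /=; tauto.
- by move=> ? /b4; rewrite /setU /=; tauto.
- by tauto.
Qed.

Lemma is_iots_rename M A : is_iots A -> M `<=` outputs A ->
  (rhd @` M) `&` actions A = set0 -> is_iots (rename M A).
Proof.
move=> [/disjP a1 /disjP a2 /disjP a3 a4] MA /disjP fr.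
rewrite /actions in fr a4; split; [apply: disjI => a|apply: disjI => a|apply: disjI => a|].
- by move=> ia [[oa _]|/fr]; [exact: (a1 a)|apply; left; left].
- by move=> ia na; exact: (a2 a).
- by move=> [[oa _]|/fr h] na; [exact: (a3 a)|apply: h; right].
move=> s a s' [s0 a0 s0' na0 /a4 [[?|?]|?]|s0 a0 s0' Ma0 _].
- by left; left.
- by left; right; left.
- by right.
- by left; right; right; exists a0.
Qed.

Lemma shared_rhd_fresh A B a : async_composable A B -> shared A B a ->
  ~ actions A (rhd a) /\ ~ actions B (rhd a).
Proof.
by case=> _ /disjP fr ab; split=> h;
  apply: (fr (rhd a)); (try by exists a); [left|right].
Qed.

Lemma out_to_shared A B : out_to A B `<=` shared A B.
Proof. by move=> a [oa ib]; right. Qed.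

Lemma sharedC A B : shared A B = shared B A.
Proof. exact: setUC. Qed.

Lemma composableC A B : composable A B -> composable B A.
Proof. by rewrite /composable setIC sharedC. Qed.

Lemma async_composableC A B : async_composable A B -> async_composable B A.
Proof.
by case=> /composableC cBA; rewrite sharedC [X in _ `&` X]setUC; split.
Qed.

Lemma is_iots_omega A B :
  is_iots A -> async_composable A B -> is_iots (omega A B).
Proof.
move=> [/disjP a1 /disjP a2 /disjP a3 a4] cAB.
have fr b : out_to A B b -> ~ actions A (rhd b).
  by move/out_to_shared/(shared_rhd_fresh cAB) => [].
split; [apply: disjI => a|apply: disjI => a|apply: disjI => a|].
- exact: a1.
- move=> ia [na|[b /fr nb e]]; first exact: (a2 a).
  by apply: nb; rewrite e; left; left.
- move=> oa [na|[b /fr nb e]]; first exact: (a3 a).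
  by apply: nb; rewrite e; left; right.
move=> s a s' [s0 s0' q a0 _ /a4 [[?|?]|?]|s0 s0' q a0 _|s0 q a0].
- by left; left.
- by left; right.
- by right; left.
- by right; right; exists (val a0) => //; exact: set_valP.
- by left; right; have [] := set_valP a0.
Qed.

Lemma composable_omega A B : injective rhd -> is_iots A -> is_iots B ->
  async_composable A B -> composable (omega A B) (omega B A).
Proof.
move=> inj [/disjP a1 /disjP a2 /disjP a3 a4] [/disjP b1 /disjP b2 /disjP b3 b4].
move=> cAB.
have fr b : out_to A B b -> ~ actions A (rhd b) /\ ~ actions B (rhd b).
  by move/out_to_shared/(shared_rhd_fresh cAB).
have fr' b : out_to B A b -> ~ actions A (rhd b) /\ ~ actions B (rhd b).
  by move/out_to_shared; rewrite sharedC => /(shared_rhd_fresh cAB).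
have actE C D a : actions (omega C D) a ->
    actions C a \/ exists2 b, out_to C D b & rhd b = a.
  by move=> [?|[?|]]; [left; left|left; right|right].
have [cmp _] := cAB.
rewrite /composable; apply/seteqP; split=> a; last first.
  by move=> [[ia oa]|[ib ob]]; split; left; [left|right|right|left].
case=> /actE [Aa|[b ob eb]] /actE [Ba|[c oc ec]].
- exact: (compP cmp).
- by case: (fr' c oc); rewrite ec.
- by case: (fr b ob); rewrite eb.
- case: ob oc => oAb _ [_]; have -> : c = b by apply: inj; rewrite eb ec.
  by move=> /a1 /(_ oAb).
Qed.

Lemma composable_rename A B : is_iots B -> async_composable A B ->
  composable A (rename (out_to B A) B).
Proof.
move=> [/disjP b1 /disjP b2 /disjP b3 _] cAB; have [/compP cmp _] := cAB.
have fr b : out_to B A b -> ~ actions A (rhd b).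
  by move/out_to_shared; rewrite sharedC => /(shared_rhd_fresh cAB) [].
rewrite /composable; apply/seteqP; split=> a; last first.
  move=> [[ia [oa|oa]]|[ib oa]]; split.
  - by left; left.
  - by left; right; left.
  - by left; left.
  - by left; right; right.
  - by left; right.
  - by left; left.
case=> Aa [[ib|[[ob nob]|[b /fr nb e]]]|nb].
- case: (cmp a Aa) => [|[ia oB]|[_ oa]]; first by left; left.
    by case: (b1 a ib oB).
  by right.
- case: (cmp a Aa) => [|[ia _]|[ib oa]]; first by left; right.
    by case: nob.
  by right.
- by case: nb; rewrite e.
- case: (cmp a Aa) => [|[ia oB]|[ib oa]]; first by right.
    by case: (b3 a oB nb).
  by case: (b2 a ib nb).
Qed.

End Iots.

Arguments steps {Act} A X _ _.
Arguments reach {Act} A _.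

(* Main.v *)
(* If a queue is nonempty in a reachable state of the asynchronous composition,
   weak compatibility lets its head be consumed, or else yields an internal
   step.  If both queues are empty, the state (s, t) is already reachable in
   A ⊗ B^▷: in an asynchronous run, each output of A to B, together with all
   later moves of A, can be postponed until B consumes it, because in A ⊗ B^▷
   the inputs of A from B are free and so never make B wait for A.  Progress of
   A ⊗ B^▷ at (s, t) then transfers to the asynchronous composition. *)

Require Import Defs.
From mathcomp Require Import all_boot classical_sets boolp.
From Stdlib Require Import Relations.

Set Implicit Arguments.
Unset Strict Implicit.

Local Open Scope classical_set_scope.

Section Reachability.
Variables (Act : Type) (A : iots Act).

Lemma reach_step s a s' : is_iots A -> reach A s -> step A s a s' -> reach A s'.
Proof.
move=> [_ _ _ act] rs st; apply: clos_rt_rt1n.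
apply: rt_trans (clos_rt1n_rt _ _ _ _ rs) _; apply: rt_step.
by exists a; first exact: act st.
Qed.

(** [steps] grows a run at its front, while invariants are carried along its last step; hence the
    detour through [clos_refl_trans_n1]. *)
Lemma reach_ind (P : state A -> Prop) :
  P (start A) ->
  (forall s a s', reach A s -> P s -> step A s a s' -> P s') ->
  forall s, reach A s -> P s.
Proof.
move=> P0 PS s rs.
elim: (clos_rt_rtn1 _ _ _ _ (clos_rt1n_rt _ _ _ _ rs)) => //.
move=> s1 s2 [a _ st] rs1 Ps1; apply: PS Ps1 st.
exact: clos_rt_rt1n (clos_rtn1_rt _ _ _ _ rs1).
Qed.

Lemma steps_head X s s' : steps A X s s' ->
  s = s' \/ exists a s1, X a /\ step A s a s1.
Proof. by case=> [|s1 s2 [a Xa st] _]; [left|right; exists a, s1]. Qed.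

End Reachability.

(** * Exchanging the two components of a composition *)

Section Symmetry.
Variables (Act : Type) (A B : iots Act).

Lemma sync_stepC (s s' : state A) (t t' : state B) a :
  step (sync A B) (s, t) a (s', t') -> step (sync B A) (t, s) a (t', s').
Proof.
move=> st; inversion st; subst.
- by apply: SyncRight; rewrite // sharedC.
- by apply: SyncLeft; rewrite // sharedC.
- by apply: SyncBoth; rewrite // sharedC.
Qed.

Lemma actions_syncC : actions (sync A B) = actions (sync B A).
Proof.
by rewrite /actions /= sharedC (setUC (inputs A)) (setUC (outputs A))
  (setUC (internals A)).
Qed.

Lemma reach_syncC s t : reach (sync A B) (s, t) -> reach (sync B A) (t, s).
Proof.
rewrite /reach /= /steps -actions_syncC => rst.
apply: clos_rt_rt1n; move: (clos_rt1n_rt _ _ _ _ rst).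
pose swap (x : state (sync A B)) : state (sync B A) := (x.2, x.1).
rewrite -[(t, s)]/(swap (s, t)) -[(start B, start A)]/(swap (start A, start B)).
elim=> [x y [a Xa st]|x|x y z _ IH1 _ IH2].
- apply: rt_step; exists a => //; case: x y st => [s1 t1] [s2 t2].
  exact: sync_stepC.
- exact: rt_refl.
- exact: rt_trans IH1 IH2.
Qed.

End Symmetry.

Lemma weakly_sync_compatibleC (Act : Type) (C D : iots Act) :
  weakly_sync_compatible C D -> weakly_sync_compatible D C.
Proof.
case=> cCD l r; split=> [|s t a s' rs|s t a s' rs]; first exact: composableC.
- exact: r _ _ _ _ (reach_syncC rs).
- exact: l _ _ _ _ (reach_syncC rs).
Qed.

Lemma autonomously_deadlock_free_syncC (Act : Type) (C D : iots Act) X :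
  autonomously_deadlock_free (sync C D) X ->
  autonomously_deadlock_free (sync D C) X.
Proof.
move=> df [t s] /reach_syncC /df [a [[s' t'] [st nX]]].
by exists a, (t', s'); split=> //; apply: sync_stepC.
Qed.

Lemma deadlock_free_syncC (Act : Type) (C D : iots Act) :
  deadlock_free (sync C D) -> deadlock_free (sync D C).
Proof.
move=> df [t s] /reach_syncC /df [a [[s' t'] st]].
by exists a, (t', s'); apply: sync_stepC.
Qed.

(** Compatibility gives [D] a run of internal steps followed by [a]. If that run is empty, [C] and
    [D] synchronise on [a] now; otherwise its first step is internal to [D], hence unshared, and [D]
    takes it alone. *)
Lemma weakly_sync_compatible_progress (Act : Type) (C D : iots Act) s t a s' :
  is_iots D -> weakly_sync_compatible C D -> reach (sync C D) (s, t) ->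
  (outputs C `&` inputs D) a -> step C s a s' ->
  exists b u, step (sync C D) (s, t) b u.
Proof.
move=> [_ inD onD _] [_ l _] rst oia sa.
have nsh b : internals D b -> ~ shared C D b.
  move=> nb [[_ ob]|[ib _]].
  - by have : (outputs D `&` internals D) b by []; rewrite onD.
  - by have : (inputs D `&` internals D) b by []; rewrite inD.
have [t1 [t' [/steps_head [tt1|[b [t2 [nb tb]]]] ta]]] := l _ _ _ _ rst oia sa.
- exists a, (s', t'); apply: SyncBoth => //; last by rewrite tt1.
  by case: oia; right.
- by exists b, (s, t2); apply: SyncRight => //; apply: nsh.
Qed.

(* [emits M s w s']: a run from [s] to [s'] whose labels in [M] spell [w] *)
Inductive emits (Act : Type) (A : iots Act) (M : set Act) :
    state A -> seq M -> state A -> Prop :=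
  | EmitsNil s : emits s ([::] : seq M) s
  | EmitsSilent s a s1 (w : seq M) s' :
      ~ M a -> step A s a s1 -> emits s1 w s' -> emits s w s'
  | EmitsCons s (a : M) s1 (w : seq M) s' : step A s (val a) s1 -> emits s1 w s' ->
      emits s (a :: w) s'.

Section Emits.
Variables (Act : Type) (A : iots Act) (M : set Act).

(** [emits] is built from the front, whereas new moves of A are appended at the end of the postponed
    run. *)
Lemma emits_silent s (w : seq M) s1 a s' :
  emits s w s1 -> ~ M a -> step A s1 a s' -> emits s w s'.
Proof.
elim=> {s w s1} [s|s b s2 w s1 nb sb _ IH|s b s2 w s1 sb _ IH] na sa.
- exact: EmitsSilent na sa (EmitsNil _ _).
- exact: EmitsSilent nb sb (IH na sa).
- exact: EmitsCons sb (IH na sa).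
Qed.

Lemma emits_rcons s (w : seq M) s1 (a : M) s' :
  emits s w s1 -> step A s1 (val a) s' -> emits s (rcons w a) s'.
Proof.
elim=> {s w s1} [s|s b s2 w s1 nb sb _ IH|s b s2 w s1 sb _ IH] sa.
- exact: EmitsCons sa (EmitsNil _ _).
- exact: EmitsSilent nb sb (IH sa).
- exact: EmitsCons sb (IH sa).
Qed.

End Emits.

(** * Simulation of asynchronous runs in A ⊗ B^▷ *)

Section OneSide.
Variables (Act : Type) (rhd : Act -> Act) (A B : iots Act).
Hypotheses (iotsA : is_iots A) (iotsB : is_iots B).
Hypothesis compAB : async_composable rhd A B.

Notation M := (out_to A B).
Notation Brhd := (rename rhd (out_to B A) B).

Lemma out_to_rhd_fresh a : M a -> ~ actions A (rhd a) /\ ~ actions B (rhd a).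
Proof. by move=> Ma; apply: shared_rhd_fresh (out_to_shared Ma). Qed.

Lemma out_to_sym_rhd_fresh a :
  out_to B A a -> ~ actions A (rhd a) /\ ~ actions B (rhd a).
Proof.
move=> oa; apply: shared_rhd_fresh => //; rewrite sharedC.
exact: out_to_shared.
Qed.

Lemma shared_actions a : shared A B a -> actions A a /\ actions B a.
Proof. by case=> [[i o]|[i o]]; split; left; [left|right|right|left]. Qed.

(** The outputs of B to A carry fresh names in B^▷, so the inputs of A from B lose their partner and
    become free. *)
Lemma shared_rename a : shared A Brhd a <-> M a.
Proof.
split=> [[[ia [[oa noa]|[b /out_to_sym_rhd_fresh [nA _] e]]]|[ib oa]]|[oa ib]].
- by case: noa.
- by case: nA; rewrite e; left; left.
- by [].
- by right.
Qed.

Lemma is_iots_sync_rename : is_iots (sync A Brhd).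
Proof.
apply: is_iots_sync => //; last exact: composable_rename.
apply: is_iots_rename => // [a [] //|].
by rewrite -subset0 => _ [[a /out_to_sym_rhd_fresh [_ nB] <-] /nB].
Qed.

(** A run emitting nothing uses only labels unshared in A ⊗ B^▷, so A catches up alone. *)
Lemma reach_emits_nil s0 s t :
  reach (sync A Brhd) (s0, t) -> emits s0 ([::] : seq M) s ->
  reach (sync A Brhd) (s, t).
Proof.
move=> + em; move Ew: [::] em => w em.
elim: em Ew => {s0 w s} [//|s0 a s1 w s nMa sa _ IH Ew rs|//].
apply: IH => //; apply: reach_step rs _; first exact: is_iots_sync_rename.
by apply: SyncLeft sa => /shared_rename.
Qed.

(** A catches up alone until it emits [a], synchronises with B there, and keeps the rest of the run
    postponed. *)
Lemma reach_emits_cons s0 (a : M) q s t t' :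
  reach (sync A Brhd) (s0, t) -> emits s0 (a :: q) s ->
  step Brhd t (val a) t' ->
  exists2 s1, reach (sync A Brhd) (s1, t') & emits s1 q s.
Proof.
move=> + em; move Ew: (a :: q) em => w em.
have iots_sync := is_iots_sync_rename.
elim: em Ew => {s0 w s} [//|s0 b s1 w s nMb sb _ IH Ew rs ta|].
- apply: IH => //; apply: reach_step rs _ => //.
  by apply: SyncLeft sb => /shared_rename.
- move=> s0 b s1 w s sb em _ [eab eqw] rs ta; subst b w; exists s1 => //.
  apply: reach_step rs _ => //; apply: SyncBoth sb ta.
  by apply/shared_rename; apply: set_valP.
Qed.

(* Reading [s0] as a component of A ⊗ B^▷ lagging behind [s]: the moves of A
   postponed at [s0] emit exactly the queue of A. *)
Lemma async_reach_emits u : reach (async rhd A B) u ->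
  exists2 s0, reach (sync A Brhd) (s0, u.2.1) & emits s0 u.1.2 u.1.1.
Proof.
have iots_sync := is_iots_sync_rename.
elim/reach_ind=> {u} [|u a u' _ [s0 rs em] st].
  by exists (start A); [apply: rt1n_refl|apply: EmitsNil].
case: st rs em => {u a u'} [x x' y a nsh xs|x y y' a nsh ys|x x' y y' a sh xs ys].
(* A moves alone, possibly enqueueing: the move joins the postponed run and [s0] stays. *)
- case: xs nsh => {x x' a} [s s' q a nMa sa|s s' q a sa|s q a] nsh /= rs em.
  + by exists s0 => //; apply: emits_silent em nMa sa.
  + by exists s0 => //; apply: emits_rcons em sa.
  + by case: nsh; apply/out_to_shared/set_valP.
(* A move of B alone is followed at once, enqueueing being the renamed output. *)
- case: ys nsh => {y y' a} [t t' p a noa ta|t t' p a ta|t p a] nsh /= rs em.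
  + exists s0 => //; apply: reach_step rs _ => //.
    apply: (@SyncRight _ A Brhd _ _ _ a); last exact: RenameOther.
    by move/shared_rename => Ma; apply: nsh; apply: out_to_shared.
  + exists s0 => //; apply: reach_step rs _ => //.
    have oa : out_to B A (val a) by apply: set_valP.
    apply: (@SyncRight _ A Brhd _ _ _ (rhd (val a))); last exact: RenameRhd.
    have [nA _] := out_to_sym_rhd_fresh oa.
    by move/shared_rename => [orA _]; apply: nA; left; right.
  + by exists s0.
- have [Aa Ba] : actions A a /\ actions B a by apply: shared_actions.
  case: xs sh Aa Ba ys => {x x' a} [s s' q a nMa sa|s s' q a sa|s q a] sh Aa Ba ys.
  (* Here A consumes a letter from the queue of B. The state of B does not change, and the move of A
     is postponed like any other. *)
  + have oa : out_to B A a.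
      by case: sh => [[ia ob]|[ib oA]]; [split|case: nMa; split].
    case: ys oa nMa sa {sh Aa} Ba => {y y' a} [t t' p a noa //|t t' p a _|t p a] /=.
    * by case: (out_to_sym_rhd_fresh (set_valP a)).
    * by move=> _ nMa sa _ rs em; exists s0 => //; apply: emits_silent em nMa sa.
  + by case: (out_to_rhd_fresh (set_valP a)).
  (* Here B consumes the head of the queue of A, which forces the postponed moves of A up to its
     emission. *)
  + move=> /= rs em; have [oa ib] : M (val a) by apply: set_valP.
    have noa : ~ out_to B A (val a).
      move=> [ob _]; have [iob _ _ _] := iotsB.
      by have : (inputs B `&` outputs B) (val a) by []; rewrite iob.
    move Eb: (val a) ys => b ys.
    case: ys rs Eb => {y y' b} [t t' p b nob tb|t t' p b _|t p b] rs Eb.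
    * by apply: reach_emits_cons rs em _; rewrite Eb; apply: RenameOther.
    * by case: (out_to_sym_rhd_fresh (set_valP b)) => + _; rewrite -Eb.
    * by case: noa; rewrite Eb; apply: set_valP.
Qed.

Lemma async_empty_queues_progress s t :
  autonomously_deadlock_free (sync A Brhd) (inputs A `&` outputs B) ->
  reach (async rhd A B) ((s, [::]), (t, [::])) ->
  exists a u, step (async rhd A B) ((s, [::]), (t, [::])) a u.
Proof.
move=> df /async_reach_emits [s0 /= rs em].
have [a [u [st nX]]] := df _ (reach_emits_nil rs em).
have sync_label_fresh b : shared A B b -> ~ shared A B (rhd b).
  move=> /(shared_rhd_fresh compAB) [nA _] /shared_actions [Ab _].
  exact: nA.
inversion st as [? s' ? ? nsh sa|? ? t' ? nsh ta|? s' ? t' ? sh sa ta]; subst.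
(* By autonomy the label is not an input of A from B, which would need a letter in the empty queue
   of B. *)
- have nMa : ~ M a by move/shared_rename.
  exists a, ((s', [::]), (t, [::])); apply: SyncLeft; last exact: OmegaMove.
  by case=> [//|[ib oa]]; apply: nMa.
- case: ta nsh {st nX rs} => {t a t'} [t a t' noa ta|t a t' oa ta] nsh.
  + exists a, ((s, [::]), (t', [::])); apply: SyncRight; last exact: OmegaMove.
    by case=> [[ia ob]|[ib oa]]; [apply: noa|apply/nsh/shared_rename].
  + pose a' : out_to B A := SigSub (mem_set oa).
    exists (rhd a), ((s, [::]), (t', rcons [::] a')); apply: SyncRight.
      by apply: sync_label_fresh; rewrite sharedC; apply: out_to_shared.
    exact: (@OmegaEnqueue _ rhd B A t t' [::] a').
(* A synchronisation in A ⊗ B^▷ becomes an enqueueing step of A, which needs no partner. *)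
- have Ma : M a by apply/shared_rename.
  pose a' : out_to A B := SigSub (mem_set Ma).
  exists (rhd a), ((s', rcons [::] a'), (t, [::])); apply: SyncLeft.
    by apply: sync_label_fresh; apply: out_to_shared.
  exact: (@OmegaEnqueue _ rhd A B s s' [::] a').
Qed.

Lemma async_deadlock_free_left :
  weakly_async_compatible rhd A B ->
  autonomously_deadlock_free (sync A Brhd) (inputs A `&` outputs B) ->
  async_deadlock_free rhd A B.
Proof.
have iotsOA := is_iots_omega iotsA compAB.
have iotsOB := is_iots_omega iotsB (async_composableC compAB).
move=> compat df [[s [|a q]] [t p]] rst; last first.
  (* The head of a nonempty queue is always on offer as an output of [omega]. *)
  exact: (weakly_sync_compatible_progress iotsOB compat rst (set_valP a)
    (OmegaDequeue _ _ _ _)).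
case: p rst => [|a p] rst; first exact: async_empty_queues_progress.
have [b [[y x] st]] := weakly_sync_compatible_progress iotsOA
  (weakly_sync_compatibleC compat) (reach_syncC rst) (set_valP a)
  (OmegaDequeue _ _ _ _).
exists b, (x, y); exact: sync_stepC st.
Qed.

End OneSide.

Theorem theorem6p6 (Act : Type) (rhd : Act -> Act) (rhd_inj : injective rhd)
    (A B : iots Act) (iotsA : is_iots A) (iotsB : is_iots B)
    (compAB : async_composable rhd A B)
    (compatAB : weakly_async_compatible rhd A B)
    (dfAB : autonomously_deadlock_free
              (sync A (rename rhd (out_to B A) B)) (inputs A `&` outputs B)
         \/ autonomously_deadlock_free
              (sync (rename rhd (out_to A B) A) B) (inputs B `&` outputs A)) :
  async_deadlock_free rhd A B.
Proof.
case: dfAB => [df|/autonomously_deadlock_free_syncC df].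
  exact: async_deadlock_free_left.
apply/deadlock_free_syncC/async_deadlock_free_left => //.
- exact: async_composableC.
- exact: weakly_sync_compatibleC.
Qed.
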